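(* Let $\mathcal S(\lambda,\bar c,\bar p)$ be an iterated function scheme of similarities with stationary measure $\mu$. Assume that for some $\alpha>0$ there exist an admissible compact interval $J\subset\mathbb R$ and a function $\psi:\mathbb R\to[0,\infty)$ which vanishes outside $J$ and which on $J$ is positive and bounded away from $0$ and from infinity, such that for every $x\in J$ $$[\mathcal D^{(2)}_{\alpha,\mathcal S}\psi](x)<\psi(x).$$ Then $$\dim_H(\mu)\ge D_2(\mu)\ge\alpha .$$
   Context: An iterated function scheme of similarities $\mathcal S(\lambda,\bar c,\bar p)$ consists of $0<\lambda<1$, $\bar c=(c_1,\dots,c_k)\in\mathbb R^k$ and a probability vector $\bar p=(p_1,\dots,p_k)$ with $0<p_j<1$, $\sum_j p_j=1$; its maps are $f_j(x)=\lambda x+c_j$, $1\le j\le k$. Its stationary measure is the unique Borel probability measure $\mu$ on $\mathbb R$ with $\mu=\sum_{j=1}^k p_j (f_j)_*\mu$. An interval $J$ is ($\lambda$-)admissible for $\mathcal S$ if there is a (nonempty) interval $J_\lambda\subset\mathbb R$ with $f_j(J_\lambda)\subset J_\lambda$ for all $j$ such that the interior of $J$ contains the closure of $\{x-y\mid x,y\in J_\lambda\}$. The symmetric diffusion operator acts on functions $\psi:\mathbb R\to\mathbb R$ by $$[\mathcal D^{(2)}_{\alpha,\mathcal S}\psi](x)=\lambda^{-\alpha}\sum_{i,j=1}^k p_ip_j\,\psi\left(\frac{x-c_i+c_j}{\lambda}\right).$$ The correlation dimension of a Borel probability measure $\mu$ on $\mathbb R$ is $D_2(\mu)=\sup\{\alpha\mid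 I(\mu,\alpha)<+\infty\}$, where $I(\mu,\alpha)=\int_{\mathbb R}\int_{\mathbb R}|x-y|^{-\alpha}\,\mu(dx)\,\mu(dy)$ (with $0^{-\alpha}=+\infty$ for $\alpha>0$). The Hausdorff dimension of $\mu$ is $\dim_H(\mu)=\inf\{\dim_H(X)\mid X \text{ Borel},\ \mu(X)=1\}$. *)

(* Defs.v *)
From HB Require Import structures.
From mathcomp Require Import all_boot all_order all_algebra.
From mathcomp Require Import all_classical all_reals all_analysis.

Set Implicit Arguments.
Unset Strict Implicit.
Unset Printing Implicit Defensive.

Import Order.TTheory GRing.Theory Num.Theory.
Import numFieldNormedType.Exports.

Local Open Scope classical_set_scope.
Local Open Scope ring_scope.

(* The hypotheses on the weights force at least two maps. *)
Record ifs (R : realType) := IFS {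
  ifs_size : nat;
  ifs_ratio : R;
  ifs_trans : 'I_ifs_size -> R;
  ifs_prob : 'I_ifs_size -> R;
  ifs_ratio_itv : 0 < ifs_ratio < 1;
  ifs_prob_itv : forall j, 0 < ifs_prob j < 1;
  ifs_prob_sum : \sum_j ifs_prob j = 1 }.

Definition ifs_map (R : realType) (S : ifs R) (j : 'I_(ifs_size S)) (x : R) : R :=
  ifs_ratio S * x + ifs_trans j.
Arguments ifs_map {R} S j x.

Definition stationary (R : realType) (S : ifs R)
    (mu : probability (measurableTypeR R) R) : Prop :=
  forall A : set (measurableTypeR R), measurable A ->
    mu A = (\sum_(j < ifs_size S)
              (ifs_prob j)%:E * pushforward mu (ifs_map S j) A)%E.

Definition admissible (R : realType) (S : ifs R) (J : set R) : Prop :=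
  is_interval J /\
  exists Jl : set R,
    [/\ is_interval Jl, Jl !=set0,
        forall j : 'I_(ifs_size S), ifs_map S j @` Jl `<=` Jl &
        closure [set x - y | x in Jl & y in Jl] `<=` interior J].

Definition sym_diffusion (R : realType) (alpha : R) (S : ifs R)
    (psi : R -> R) (x : R) : R :=
  ifs_ratio S `^ (- alpha) *
  \sum_(i < ifs_size S) \sum_(j < ifs_size S)
     ifs_prob i * ifs_prob j *
     psi ((x - ifs_trans i + ifs_trans j) / ifs_ratio S).

(* The diagonal is treated separately because [powR] gives [0 `^ (- alpha) = 0]
   for [alpha != 0]. *)
Definition riesz_kernel (R : realType) (alpha x y : R) : \bar R :=
  if (x == y) && (0 < alpha) then +oo%E else (`|x - y| `^ (- alpha))%:E.

Definition energy (R : realType) (mu : probability (measurableTypeR R) R)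
    (alpha : R) : \bar R :=
  (\int[mu]_y \int[mu]_x riesz_kernel alpha x y)%E.

Definition correlation_dim (R : realType)
    (mu : probability (measurableTypeR R) R) : \bar R :=
  ereal_sup [set alpha%:E | alpha in [set a : R | (energy mu a < +oo)%E]].

(* [diam set0 = -oo], since [ereal_sup set0 = -oo]. *)
Definition diam (R : realType) (U : set R) : \bar R :=
  ereal_sup [set `|x - y|%:E | x in U & y in U].

(* [diam U ^ s], with the usual conventions that the empty set has weight 0 and
   that a point has weight 1 when [s = 0]. *)
Definition diam_pow (R : realType) (s : R) (U : set R) : \bar R :=
  if U == set0 then 0%E else (diam U `^ s)%E.

Definition hausdorff_premeasure (R : realType) (s delta : R) (X : set R) : \bar R :=
  ereal_inf [set (\sum_(0 <= i <oo) diam_pow s (U i))%E |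
    U in [set U : nat -> set R | X `<=` \bigcup_i U i /\
                                 forall i, (diam (U i) <= delta%:E)%E]].

Definition hausdorff_measure (R : realType) (s : R) (X : set R) : \bar R :=
  ereal_sup [set hausdorff_premeasure s delta X | delta in [set d : R | 0 < d]].

Definition hausdorff_dim (R : realType) (X : set R) : \bar R :=
  ereal_inf [set s%:E | s in [set s : R | 0 <= s /\ hausdorff_measure s X = 0%E]].

Definition hausdorff_dim_measure (R : realType)
    (mu : probability (measurableTypeR R) R) : \bar R :=
  ereal_inf [set hausdorff_dim X | X in
    [set X : set (measurableTypeR R) | measurable X /\ mu X = 1%E]].

(* Main.v *)
(* By stationarity, the correlation integrals
   F n z = (mu x mu) {|x - y - z| <= lambda^n r} satisfy
   lambda^(-(n+1) alpha) F (n+1) = D (lambda^(-n alpha) F n), with D the symmetric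
   diffusion operator. Since mu lives on an interval whose difference set is inside
   J, F 0 <= psi / m where m is a lower bound of psi on J; as D psi <= psi also off
   J and D is monotone, F n z <= lambda^(n alpha) psi z / m. At z = 0 this makes the
   energy of mu finite at each exponent s < alpha. Conversely, if the energy at s is
   finite, the s-potential of mu is bounded on a set of positive measure, and the
   mass distribution principle shows that no set of full measure has Hausdorff
   dimension less than s. *)
Require Import Defs.
From HB Require Import structures.
From mathcomp Require Import all_boot all_order all_algebra.
From mathcomp Require Import all_classical all_reals all_analysis measurable_realfun.
From mathcomp Require Import ring lra.
Import Order.TTheory GRing.Theory Num.Theory.
Import numFieldNormedType.Exports.
Local Open Scope classical_set_scope.
Local Open Scope ring_scope.

Set Implicit Arguments.
Unset Strict Implicit.
Unset Printing Implicit Defensive.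

(** * Correlation integrals and their self-similarity *)

(** The shift [z] is needed even to study [z = 0], since the recursion moves the centre. The
    iterated integral matches the form of [energy]. *)
Definition correlation_integral (R : realType)
    (mu : probability (measurableTypeR R) R) (z r : R) : \bar R :=
  (\int[mu]_y mu [set x | (`|x - y - z| <= r)%R])%E.

Lemma measurable_dist_le (R : realType) (y z r : R) :
  measurable ([set x | `|x - y - z| <= r] : set (measurableTypeR R)).
Proof.
rewrite [X in measurable X](_ : _ = `[y + z - r, y + z + r]%classic) //.
by apply/seteqP; split => x /=; rewrite in_itv /= ler_norml => /andP[? ?];
  apply/andP; split; lra.
Qed.

Lemma measurable_diff (R : realType) :
  measurable_fun setT
    (fun p : measurableTypeR R * measurableTypeR R => p.1 - p.2 : measurableTypeR R).
Proof. by apply: measurable_funB; [exact: measurable_fst|exact: measurable_snd]. Qed.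

Lemma measurable_mu_dist_le (R : realType)
    (mu : probability (measurableTypeR R) R) (z r : R) :
  measurable_fun setT
    (fun y : measurableTypeR R => mu [set x | `|x - y - z| <= r]).
Proof.
pose A : set (measurableTypeR R * measurableTypeR R) :=
  [set p | `|p.1 - p.2 - z| <= r].
have mB : measurable ([set t | `|t - z| <= r] : set (measurableTypeR R)).
  by have := measurable_dist_le 0 z r; under eq_set do rewrite subr0.
have mA : measurable A by rewrite -[A]setTI; exact: (measurable_diff measurableT mB).
rewrite (_ : (fun y => _) = mu \o ysection A); first exact: measurable_fun_ysection.
apply/funext => y /=; congr (mu _).
by apply/seteqP; split=> x; rewrite /ysection /= inE.
Qed.

Lemma measurable_ifs_map (R : realType) (S : ifs R) (j : 'I_(ifs_size S)) :
  measurable_fun [set: measurableTypeR R] (ifs_map S j : measurableTypeR R -> measurableTypeR R).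
Proof. by apply: measurable_funD => //; exact: measurable_realfun.measurable_funM. Qed.

(** Stationarity is an identity on sets, so [mu] is a finite sum of scaled pushforwards as a
    measure; linearity in the measure and change of variables do the rest. *)
Lemma stationary_integral (R : realType) (S : ifs R)
    (mu : probability (measurableTypeR R) R) (f : R -> \bar R) :
  stationary S mu ->
  measurable_fun [set: measurableTypeR R] f -> (forall x, (0 <= f x)%E) ->
  (\int[mu]_x f x =
   \sum_(j < ifs_size S) (ifs_prob j)%:E * \int[mu]_x f (ifs_map S j x))%E.
Proof.
move=> st mf f0.
have p0 j : 0 <= ifs_prob (i := S) j by have /andP[/ltW] := ifs_prob_itv j.
pose g (j : 'I_(ifs_size S)) : measurableTypeR R -> measurableTypeR R := ifs_map S j.
have mg j : measurable_fun setT (g j) by exact: measurable_ifs_map.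
pose push j : {measure set (measurableTypeR R) -> \bar R} := pushforward mu (g j).
(* [msum] takes a family indexed by [nat]; indices beyond the number of maps get the zero
   measure. *)
pose m_ (n : nat) : {measure set (measurableTypeR R) -> \bar R} :=
  if insub n is Some j then mscale (NngNum (p0 j)) (push mg j)
  else mzero.
rewrite (eq_measure_integral (msum m_ (ifs_size S))) => [|A mA _]; last first.
  rewrite [LHS](st A mA) /msum; apply: eq_bigr => j _.
  by rewrite /m_ valK.
rewrite ge0_integral_measure_sum//; apply: eq_bigr => j _.
rewrite /m_ valK ge0_integral_mscale//=; congr (_ * _)%E.
by rewrite ge0_integral_pushforward.
Qed.

(** Stationarity is applied to [y] with [f_j], then to [x] with [f_i]. Writing [l] for the ratio,
    [f_i x - f_j y - z = l (x - y - (z - c_i + c_j) / l)], so the factor [l] cancels from the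
    radius. *)
Lemma correlation_integral_rec (R : realType) (S : ifs R)
    (mu : probability (measurableTypeR R) R) (z r : R) :
  stationary S mu ->
  (correlation_integral mu z (ifs_ratio S * r) =
   \sum_(j < ifs_size S) \sum_(i < ifs_size S) (ifs_prob j * ifs_prob i)%:E *
     correlation_integral mu
       ((z - ifs_trans i + ifs_trans j) / ifs_ratio S)%R r)%E.
Proof.
move=> st; have /andP[l0 _] := ifs_ratio_itv S.
have p0 (j : 'I_(ifs_size S)) : 0 <= ifs_prob j.
  by have /andP[/ltW] := ifs_prob_itv j.
rewrite /correlation_integral (stationary_integral st)//; last first.
  exact: measurable_mu_dist_le.
apply: eq_bigr => j _.
transitivity ((ifs_prob j)%:E * \int[mu]_y (\sum_(i < ifs_size S) (ifs_prob i)%:E *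
    mu [set x | (`|x - y - (z - ifs_trans i + ifs_trans j) / ifs_ratio S| <= r)%R]))%E.
  congr (_ * _)%E; apply: eq_integral => y _.
  rewrite [LHS](st _ (measurable_dist_le _ _ _)); apply: eq_bigr => i _.
  rewrite /pushforward; congr (_ * mu _)%E; apply/seteqP; split => x /=;
    rewrite /ifs_map (_ : _ - _ - z = ifs_ratio S *
      (x - y - (z - ifs_trans i + ifs_trans j) / ifs_ratio S));
    rewrite ?normrM ?(gtr0_norm l0) ?ler_pM2l//; field; exact: lt0r_neq0.
rewrite ge0_integral_sum//; last 2 first.
- by move=> i; apply: measurable_funeM; exact: measurable_mu_dist_le.
- by move=> i y _; rewrite mule_ge0// lee_fin.
rewrite ge0_sume_distrr; last first.
  by move=> i _; apply: integral_ge0 => y _; rewrite mule_ge0// lee_fin.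
apply: eq_bigr => i _; rewrite EFinM -muleA ge0_integralZl//.
- exact: measurable_mu_dist_le.
- by rewrite lee_fin.
Qed.

Lemma correlation_integral_le1 (R : realType)
    (mu : probability (measurableTypeR R) R) (z r : R) :
  (correlation_integral mu z r <= 1)%E.
Proof.
apply: (@le_trans _ _ (\int[mu]_y 1)%E); last first.
  by rewrite integral_cst// mul1e; exact: probability_le1.
apply: ge0_le_integral => //; first exact: measurable_mu_dist_le.
by move=> y _; apply: probability_le1; exact: measurable_dist_le.
Qed.

(** Points of [[a, b]] differ by at most [b - a], so no pair of them is counted; the integrand is
    dominated by the indicator of the null complement. *)
Lemma correlation_integral_eq0 (R : realType)
    (mu : probability (measurableTypeR R) R) (a b z r : R) :
  mu (~` `[a, b]) = 0%E -> b - a + r < `|z| -> correlation_integral mu z r = 0%E.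
Proof.
move=> ab0 zr.
have mab : measurable (~` `[a, b] : set (measurableTypeR R)).
  by apply: measurableC; exact: measurable_itv.
apply/eqP; rewrite eq_le; apply/andP; split; last by apply: integral_ge0.
apply: (@le_trans _ _ (mu (~` `[a, b]))); last by rewrite ab0.
rewrite -[X in mu X]setIT -integral_indic//.
apply: ge0_le_integral => //; first exact: measurable_mu_dist_le.
  by apply/measurable_EFinP; exact: measurable_indic.
move=> y _; rewrite indicE; have [_|] := boolP (y \in _).
  by apply: probability_le1; exact: measurable_dist_le.
rewrite notin_setE => /contrapT yab.
apply: (@le_trans _ _ (mu (~` `[a, b]))); last by rewrite ab0.
apply: le_measure; rewrite ?inE//; first exact: measurable_dist_le.
move=> x /= xz xab; move: xz; apply/negP; rewrite -ltNge.
move: yab xab zr; rewrite /= !in_itv/= => /andP[? ?] /andP[? ?].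
have := ler_normB (x - y) (x - y - z); rewrite (_ : x - y - (x - y - z) = z); last ring.
have : `|x - y| <= b - a by rewrite ler_norml; apply/andP; split; lra.
lra.
Qed.

(** * Support of the stationary measure and room inside [J] *)

Lemma exprn_lt_exists (R : realType) (q e : R) :
  0 < q < 1 -> 0 < e -> exists n, q ^+ n < e.
Proof.
move=> /andP[q0 q1] e0.
have := @cvg_geometric _ 1 q; rewrite ger0_norm ?(ltW q0)// => /(_ q1).
move=> /cvgrPdist_lt/(_ e e0)[N _ /(_ N (leqnn N))]/=.
by rewrite mul1r sub0r normrN ger0_norm ?exprn_ge0 ?(ltW q0)//; exists N.
Qed.

(* The maps contract towards [a, b], so a point sent outside its [t]-neighbourhood lies
   outside the [t / lambda]-neighbourhood: the mass outside the former is at most the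
   mass outside the [t / lambda^n]-neighbourhood, which tends to 0. *)
Lemma stationary_supp (R : realType) (S : ifs R)
    (mu : probability (measurableTypeR R) R) (a b t : R) :
  stationary S mu ->
  (forall j : 'I_(ifs_size S), a <= ifs_map S j a) ->
  (forall j : 'I_(ifs_size S), ifs_map S j b <= b) ->
  0 < t -> mu (~` `[a - t, b + t]) = 0%E.
Proof.
move=> st fa fb t0; have /andP[l0 l1] := ifs_ratio_itv S.
set l := ifs_ratio S in l0 l1.
pose F (s : R) : set (measurableTypeR R) := ~` `[a - s, b + s].
have mF s : measurable (F s) by apply: measurableC; exact: measurable_itv.
have F_mono s s' : s <= s' -> F s' `<=` F s.
  move=> ss' x; apply: contra_not; rewrite /= !in_itv/= => /andP[? ?].
  by apply/andP; split; lra.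
have p0 (j : 'I_(ifs_size S)) : 0 <= ifs_prob j.
  by have /andP[/ltW] := ifs_prob_itv j.
have step s : (mu (F (l * s)%R) <= mu (F s))%E.
  rewrite [leLHS](st _ (mF _)).
  apply: (@le_trans _ _ (\sum_(j < ifs_size S) (ifs_prob j)%:E * mu (F s)))%E.
    apply: lee_sum => j _.
    apply: lee_wpmul2l; first by rewrite lee_fin.
    apply: (@le_measure _ _ _ mu); rewrite ?inE//.
      by rewrite -[X in measurable X]setTI; exact: measurable_ifs_map.
    move=> x; apply: contra_not; rewrite /= !in_itv/= => /andP[xa xb].
    have := fa j; have := fb j; rewrite /ifs_map -/l => hb ha.
    have : l * (a - s) <= l * x by rewrite ler_pM2l.
    have : l * x <= l * (b + s) by rewrite ler_pM2l.
    by move=> ? ?; apply/andP; split; lra.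
  rewrite -ge0_sume_distrl => [|j _]; last by rewrite lee_fin.
  by rewrite sumEFin ifs_prob_sum mul1e.
pose G n := F (t / l ^+ n).
have tG n : (mu (F t) <= mu (G n))%E.
  elim: n => [|n IH]; first by rewrite /G expr0 divr1.
  apply: (le_trans IH); rewrite /G.
  rewrite (_ : t / l ^+ n = l * (t / l ^+ n.+1)) ?step// exprS.
  by field; rewrite expf_neq0// lt0r_neq0.
have G0 : \bigcap_n G n = set0.
  rewrite -subset0 => x Gx.
  (* Once [l ^+ n] is below this quotient, [t / l ^+ n] exceeds [|x| + |a| + |b| + 1], which puts
     [x] in the enlarged interval. *)
  have e0 : 0 < t / (`|x| + `|a| + `|b| + 1) by rewrite divr_gt0// ltr_wpDl// !addr_ge0.
  have [|n] := @exprn_lt_exists _ l _ _ e0; first by rewrite l0.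
  rewrite ltr_pdivlMr ?ltr_wpDl// ?addr_ge0// mulrC -ltr_pdivlMr ?exprn_gt0// => nt.
  apply: (Gx n I); rewrite /= in_itv/=.
  have := ler_norm x; have := ler_norm a; have := ler_norm b.
  have := ler_norm (- x); have := ler_norm (- a); have := ler_norm (- b).
  by rewrite !normrN => *; apply/andP; split; lra.
have : mu \o G @ \oo --> mu (\bigcap_n G n).
  apply: nonincreasing_cvg_mu => //.
  - exact: le_lt_trans (probability_le1 mu (mF _)) (ltry _).
  - by move=> n; exact: mF.
  - by rewrite G0.
  - move=> m n mn; apply/subsetPset; apply: F_mono.
    by rewrite ler_pM2l// lef_pV2 ?posrE ?exprn_gt0// ler_wiXn2l// ltW.
rewrite [X in mu X]G0 measure0 => G_cvg.
apply/eqP; rewrite eq_le measure_ge0 andbT.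
by apply: (cvge_to_ge G_cvg); apply: nearW.
Qed.

(** Boundedness of [J] bounds the differences in [Jl], hence [Jl] itself; take [a = inf Jl] and
    [b = sup Jl]. Both [b - a] and [a - b] are limits of differences, so they are interior to [J],
    and the interval [J] contains everything between their neighbourhoods. *)
Lemma admissible_margin (R : realType) (S : ifs R) (J : set R) :
  admissible S J -> compact J ->
  exists a b e : R, [/\ 0 < e, forall j : 'I_(ifs_size S), a <= ifs_map S j a,
    forall j : 'I_(ifs_size S), ifs_map S j b <= b &
    forall z, `|z| <= b - a + e -> J z].
Proof.
move=> [iJ [Jl [_ [x0 Jx0] fJ DJ]]] cJ; have /andP[l0 _] := ifs_ratio_itv S.
set D := [set _ - _ | _ in _ & _ in _] in DJ.
have [M [_ JM]] := compact_bounded cJ.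
have Jl_dist x y : Jl x -> Jl y -> `|x - y| <= M + 1.
  move=> Jx Jy; apply: JM; first by rewrite ltrDl.
  by apply: interior_subset; apply: DJ; apply: subset_closure; exists x => //; exists y.
have hs : has_sup Jl.
  split; first by exists x0.
  exists (x0 + (M + 1)) => x Jx; have := Jl_dist _ _ Jx Jx0.
  by rewrite ler_norml => /andP[? ?]; lra.
have hi : has_inf Jl.
  split; first by exists x0.
  exists (x0 - (M + 1)) => x Jx; have := Jl_dist _ _ Jx Jx0.
  by rewrite ler_norml => /andP[? ?]; lra.
have inJ x : closure D x -> exists2 e : R, 0 < e & ball x e `<=` J.
  by move=> /DJ /nbhs_ballP[e /= e0 eJ]; exists e.
have approx (e : R) : 0 < e -> exists x y,
    [/\ Jl x, Jl y, x <= sup Jl < x + e & y - e < inf Jl <= y].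
  move=> e0; have [x Jx xe] := sup_adherent e0 hs.
  have [y Jy ye] := inf_adherent e0 hi; exists x, y; split => //.
    by rewrite (sup_upper_bound hs Jx)/=; lra.
  by rewrite (ge_inf hi.2 Jy) andbT; lra.
have [e1 e10 J1] : exists2 e : R, 0 < e & ball (sup Jl - inf Jl) e `<=` J.
  apply: inJ => B /nbhs_ballP[e /= e0 eB].
  have [|x [y [Jx Jy /andP[? ?] /andP[? ?]]]] := approx (e / 2); first by rewrite divr_gt0.
  exists (x - y); split; first by exists x => //; exists y.
  by apply: eB; rewrite /ball/= ltr_norml; apply/andP; split; lra.
have [e2 e20 J2] : exists2 e : R, 0 < e & ball (inf Jl - sup Jl) e `<=` J.
  apply: inJ => B /nbhs_ballP[e /= e0 eB].
  have [|x [y [Jx Jy /andP[? ?] /andP[? ?]]]] := approx (e / 2); first by rewrite divr_gt0.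
  exists (y - x); split; first by exists y => //; exists x.
  by apply: eB; rewrite /ball/= ltr_norml; apply/andP; split; lra.
(* Halving makes [e] strictly smaller than both radii, as the balls are open. *)
pose e := Num.min e1 e2 / 2.
have e0 : 0 < e by rewrite divr_gt0// lt_min e10.
have me1 : Num.min e1 e2 <= e1 by rewrite ge_min lexx.
have me2 : Num.min e1 e2 <= e2 by rewrite ge_min lexx orbT.
have ee1 : e < e1 by rewrite /e; lra.
have ee2 : e < e2 by rewrite /e; lra.
exists (inf Jl), (sup Jl), e; split => //.
(* [inf Jl] need not belong to [Jl], so invariance is used at a point within [d] of it, and [d] is
   then arbitrary. *)
- move=> j; apply/ler_addgt0Pr => d d0.
  have [x [y [Jx Jy _ /andP[yd yi]]]] := approx d d0.
  have : inf Jl <= ifs_map S j y by apply: (ge_inf hi.2); apply: (fJ j); exists y.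
  have /andP[_ l1] := ifs_ratio_itv S.
  rewrite /ifs_map => h.
  have : ifs_ratio S * y <= ifs_ratio S * (inf Jl + d) by rewrite ler_pM2l; lra.
  have : ifs_ratio S * d <= d by rewrite ger_pMl// ltW.
  lra.
- move=> j; apply/ler_addgt0Pr => d d0.
  have [x [y [Jx Jy /andP[yd yi] _]]] := approx d d0.
  have : ifs_map S j x <= sup Jl by apply: (sup_upper_bound hs); apply: (fJ j); exists x.
  have /andP[_ l1] := ifs_ratio_itv S.
  rewrite /ifs_map => h.
  have : ifs_ratio S * (sup Jl - d) <= ifs_ratio S * x by rewrite ler_pM2l; lra.
  have : ifs_ratio S * d <= d by rewrite ger_pMl// ltW.
  lra.
- move=> z; rewrite ler_norml => zJ; apply: (iJ _ _ _ _ _ zJ).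
    by apply: J2; rewrite /ball/= ltr_norml; apply/andP; split; lra.
  by apply: J1; rewrite /ball/= ltr_norml; apply/andP; split; lra.
Qed.

(** * Geometric decay of the correlation integrals *)

Lemma correlation_integral_decay (R : realType) (S : ifs R)
    (mu : probability (measurableTypeR R) R) (alpha : R) (J : set R)
    (psi : R -> R) (m : R) :
  stationary S mu -> admissible S J -> compact J ->
  (forall x, ~ J x -> psi x = 0) -> 0 < m -> (forall x, J x -> m <= psi x) ->
  (forall x, J x -> sym_diffusion alpha S psi x <= psi x) ->
  exists2 r : R, 0 < r & forall n z,
    (correlation_integral mu z (ifs_ratio S ^+ n * r) <=
     ((ifs_ratio S `^ alpha) ^+ n * (psi z / m))%:E)%E.
Proof.
move=> st adm cJ psi0 m0 mpsi psi_le.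
have [iJ _] := adm; have [a [b [e [e0 fa fb eJ]]]] := admissible_margin adm cJ.
have /andP[l0 l1] := ifs_ratio_itv S; set l := ifs_ratio S in l0 l1 *.
have psi_ge x : 0 <= psi x.
  by have [/mpsi/(lt_le_trans m0)/ltW//|/psi0->] := pselect (J x).
have p0 (j : 'I_(ifs_size S)) : 0 <= ifs_prob j.
  by have /andP[/ltW] := ifs_prob_itv j.
(* The induction visits points outside [J]. There every term of the sum vanishes: a point [w] of [J]
   in its argument would force [z] into [J] by convexity. *)
have Dpsi z : sym_diffusion alpha S psi z <= psi z.
  have [/psi_le//|nJ] := pselect (J z).
  rewrite (psi0 _ nJ) /sym_diffusion big1 ?mulr0// => i _; rewrite big1// => j _.
  rewrite psi0 ?mulr0// -/l => Jw; apply: nJ.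
  (* [d] is the difference of the fixed points of [f_i] and [f_j], so it lies within [b - a] of 0,
     and [z] is a convex combination of [w] and [d]. *)
  set w := (_ / l) in Jw; pose d := (ifs_trans i - ifs_trans j) / (1 - l).
  have hd : (1 - l) * d = ifs_trans i - ifs_trans j.
    by rewrite mulrC divfK// gt_eqF// subr_gt0.
  have zE : z = l * w + (1 - l) * d by rewrite hd /w; field; exact: lt0r_neq0.
  have Jd : J d.
    apply: eJ; rewrite ler_norml.
    have := fa i; have := fa j; have := fb i; have := fb j; rewrite /ifs_map -/l.
    move=> h1 h2 h3 h4.
    have l1' : 0 < 1 - l by lra.
    have h : d <= b - a by rewrite -(ler_pM2l l1') hd; lra.
    have h' : a - b <= d by rewrite -(ler_pM2l l1') hd; lra.
    by apply/andP; split; lra.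
  have [dw|wd] := leP d w.
  - by apply: (iJ _ _ Jd Jw); rewrite zE; apply/andP; split; nra.
  - by apply: (iJ _ _ Jw Jd); rewrite zE; apply/andP; split; nra.
(* The support is known up to [e / 4] on each side; with the radius [e / 4] this consumes [3 e / 4]
   of the margin [e]. *)
exists (e / 4) => [|n]; first by rewrite divr_gt0.
elim: n => [z|n IH z].
  rewrite !expr0 !mul1r; have [Jz|nJ] := pselect (J z).
    rewrite (le_trans (correlation_integral_le1 _ _ _))// lee_fin.
    by rewrite ler_pdivlMr// mul1r mpsi.
  have t0 : 0 < e / 4 by rewrite divr_gt0.
  rewrite (correlation_integral_eq0 (stationary_supp st fa fb t0)).
    by rewrite psi0// mul0r.
  by rewrite ltNge; apply/negP => h; apply/nJ/eJ; lra.
rewrite exprS -mulrA (correlation_integral_rec _ _ st).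
apply: (@le_trans _ _ (\sum_(j < ifs_size S) \sum_(i < ifs_size S)
    (ifs_prob j * ifs_prob i * ((l `^ alpha) ^+ n *
    (psi ((z - ifs_trans i + ifs_trans j) / l) / m)))%:E)%E).
  apply: lee_sum => j _; apply: lee_sum => i _; rewrite [leRHS]EFinM.
  by apply: lee_wpmul2l; [rewrite lee_fin mulr_ge0|exact: IH].
under eq_bigr do rewrite sumEFin.
rewrite sumEFin lee_fin.
have -> : \sum_(j < ifs_size S) \sum_(i < ifs_size S)
    ifs_prob j * ifs_prob i * ((l `^ alpha) ^+ n *
    (psi ((z - ifs_trans i + ifs_trans j) / l) / m)) =
    (l `^ alpha) ^+ n.+1 / m * sym_diffusion alpha S psi z.
  (* The factor [l^(-alpha)] of the operator absorbs one power, from [n.+1] down to [n]. *)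
  rewrite /sym_diffusion exchange_big/= -/l powRN mulrA.
  rewrite (_ : _ / m / _ = (l `^ alpha) ^+ n / m); last first.
    by rewrite exprS; field; rewrite !gt_eqF// powR_gt0.
  rewrite mulr_sumr; apply: eq_bigr => i _; rewrite mulr_sumr.
  by apply: eq_bigr => j _; ring.
rewrite [leRHS]mulrA [leRHS]mulrAC ler_wpM2l//.
by rewrite divr_ge0 ?exprn_ge0 ?powR_ge0// ltW.
Qed.

(** * Riesz kernels and finiteness of the energy *)

Lemma riesz_kernel_ge0 (R : realType) (s x y : R) : (0 <= riesz_kernel s x y)%E.
Proof. by rewrite /riesz_kernel; case: ifP => // _; rewrite lee_fin powR_ge0. Qed.

Lemma measurable_riesz_kernel (R : realType) (s : R) :
  measurable_fun setT (fun p : measurableTypeR R * measurableTypeR R =>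
    riesz_kernel s p.1 p.2).
Proof.
apply: measurable_fun_ifT => //.
  have [s0|s0] := boolP (0 < s); last first.
    by under eq_fun do rewrite andbF; exact: measurable_cst.
  under eq_fun do rewrite andbT.
  by apply: measurable_fun_eqr; [exact: measurable_fst|exact: measurable_snd].
apply/measurable_EFinP.
apply: (@measurableT_comp _ _ _ _ _ _ (fun t : measurableTypeR R => `|t| `^ (- s))).
  apply: (@measurableT_comp _ _ _ _ _ _ (fun t : R => t `^ (- s))).
    exact: measurable_powR.
  exact: normr_measurable.
exact: measurable_diff.
Qed.

Lemma measurable_riesz_kernel_l (R : realType) (s y : R) :
  measurable_fun setT (fun x : measurableTypeR R => riesz_kernel s x y).
Proof.
exact: (measurableT_comp (measurable_riesz_kernel s) (measurable_pair2 y)).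
Qed.

Lemma measurable_riesz_potential (R : realType) (s : R)
    (mu : probability (measurableTypeR R) R) :
  measurable_fun setT
    (fun y : measurableTypeR R => (\int[mu]_x riesz_kernel s x y)%E).
Proof.
apply: (measurable_fun_fubini_tonelli_G
  (fun p : measurableTypeR R * measurableTypeR R => riesz_kernel s p.1 p.2)).
  exact: measurable_riesz_kernel.
by move=> p; exact: riesz_kernel_ge0.
Qed.

Lemma nneseries_ge_term (R : realType) (u : nat -> \bar R) (k : nat) :
  (forall n, (0 <= u n)%E) -> (u k <= \sum_(0 <= n <oo) u n)%E.
Proof.
move=> u0; apply: le_trans (nneseries_lim_ge k.+1 _); last by [].
by rewrite big_nat_recr//= leeDr// sume_ge0.
Qed.

Lemma geometric_nneseries_lty (R : realType) (a q : R) :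
  0 <= a -> 0 < q < 1 -> (\sum_(0 <= n <oo) (a * q ^+ n)%:E < +oo)%E.
Proof.
move=> a0 /andP[q0 q1]; apply: le_lt_trans (ltry (a / (1 - q))).
apply: lime_le.
  by apply: is_cvg_nneseries => n _ _; rewrite lee_fin mulr_ge0// exprn_ge0// ltW.
apply: nearW => n; rewrite sumEFin lee_fin.
by apply: geometric_le_lim => //; rewrite ger0_norm// ltW.
Qed.

(* The term indexed by [n] accounts for the pairs with
   [q ^+ n.+1 * r < |x - y| <= q ^+ n * r]; on the diagonal the series diverges. *)
Lemma riesz_kernel_le_series (R : realType) (s q r x y : R) :
  0 < s -> 0 < q < 1 -> 0 < r ->
  (riesz_kernel s x y <= (r `^ (- s))%:E +
    \sum_(0 <= n <oo) ((q `^ s * r `^ s)^-1 / (q `^ s) ^+ n)%:E *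
      (\1_[set x | (`|x - y - 0| <= q ^+ n * r)%R] x)%:E)%E.
Proof.
move=> s0 /andP[q0 q1] r0.
have qs0 : 0 < q `^ s by rewrite powR_gt0.
have qs1 : q `^ s < 1.
  have := gt0_ltr_powR s0 (ltW q0) ler01 q1.
  by rewrite powR1.
have rs0 : 0 < r `^ s by rewrite powR_gt0.
(* The [n]-th coefficient [c / (q^s)^n] is [(q^(n+1) r)^(-s)], the kernel at the inner radius of the
   [n]-th shell. *)
set c := (_ * _)^-1; have c0 : 0 < c by rewrite invr_gt0 mulr_gt0.
pose u (n : nat) : \bar R := ((c / (q `^ s) ^+ n)%:E *
  (\1_[set x' | (`|x' - y - 0| <= q ^+ n * r)%R] x)%:E)%E.
rewrite -/(_ + \sum_(0 <= n <oo) u n)%E.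
have u0 n : (0 <= u n)%E.
  by rewrite /u mule_ge0// lee_fin ?indicE// divr_ge0// ?ltW// exprn_gt0.
have uE n : `|x - y| <= q ^+ n * r -> u n = (c / (q `^ s) ^+ n)%:E.
  by move=> h; rewrite /u indicE mem_set ?mule1//= subr0.
have su := nneseries_ge_term _ u0.
have rs : (0 <= (r `^ (- s))%:E)%E by rewrite lee_fin powR_ge0.
rewrite /riesz_kernel s0 andbT; case: eqVneq => [xy|xy].
  apply: (@le_trans _ _ (\sum_(0 <= n <oo) u n)%E); last by rewrite leeDr.
  rewrite leye_eq; apply/eqP/eqyP => M M0.
  have [|n] := @exprn_lt_exists _ (q `^ s) (c / M) _ (divr_gt0 c0 M0).
    by rewrite qs0.
  move=> nM; apply: le_trans (su n).
  rewrite uE; last by rewrite xy subrr normr0 mulr_ge0// ?exprn_ge0// ltW.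
  rewrite lee_fin ler_pdivlMr ?exprn_gt0// mulrC -ler_pdivlMr//.
  exact: ltW.
set t := `|x - y|; have t0 : 0 < t by rewrite normr_gt0 subr_eq0.
have anti v : 0 < v -> v <= t -> t `^ (- s) <= v `^ (- s).
  move=> v0 vt; rewrite !powRN lef_pV2 ?posrE ?powR_gt0//.
  by rewrite ge0_ler_powR// ?nnegrE ?ltW.
have [rt|tr] := ltP r t.
  apply: (@le_trans _ _ (r `^ (- s))%:E); first by rewrite lee_fin anti// ltW.
  by rewrite leeDl//; apply: nneseries_ge0 => n _ _; exact: u0.
have ex : exists n, q ^+ n * r < t.
  have [|n nt] := @exprn_lt_exists _ q (t / r) _ (divr_gt0 t0 r0); first by rewrite q0.
  by exists n; rewrite -ltr_pdivlMr.
(* The least index is positive because [t <= r]; its predecessor is the shell containing [t], and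
   that single term dominates the kernel. *)
case: (ex_minnP ex) => -[|n]; first by rewrite expr0 mul1r ltNge tr.
move=> nt min.
have tn : t <= q ^+ n * r by rewrite leNgt; apply/negP => /min; rewrite ltnn.
apply: (@le_trans _ _ (u n)).
  rewrite uE// lee_fin; apply: le_trans (anti _ _ (ltW nt)) _.
    by rewrite mulr_gt0// exprn_gt0.
  have [q0' r0'] := (ltW q0, ltW r0).
  rewrite powRN powRM ?exprn_ge0// -powR_mulrn// powRAC powR_mulrn ?powR_ge0//.
  rewrite /c -invfM exprS le_eqVlt; apply/orP; left; apply/eqP.
  by congr (_^-1); ring.
by apply: (le_trans (su n)); rewrite leeDr.
Qed.

(** Integrating the shell bound termwise gives weights of order [q^(-n s)] against correlation
    integrals of order [q^(n alpha)]: a geometric series of ratio [q^(alpha - s) < 1]. *)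
Lemma energy_lty (R : realType) (mu : probability (measurableTypeR R) R)
    (q r C alpha s : R) :
  0 < q < 1 -> 0 < r -> 0 <= C -> 0 < s < alpha ->
  (forall n, (correlation_integral mu 0 (q ^+ n * r) <=
              ((q `^ alpha) ^+ n * C)%:E)%E) ->
  (energy mu s < +oo)%E.
Proof.
move=> q01 r0 C0 /andP[s0 sa] hC; have /andP[q0 q1] := q01.
set w := fun n : nat => (q `^ s * r `^ s)^-1 / (q `^ s) ^+ n.
have w0 n : 0 <= w n.
  by rewrite /w divr_ge0 ?exprn_ge0 ?invr_ge0 ?mulr_ge0 ?powR_ge0.
have rs0 : (0 <= (r `^ (- s))%:E)%E by rewrite lee_fin powR_ge0.
pose B n y : set (measurableTypeR R) := [set x | `|x - y - 0| <= q ^+ n * r].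
have mB n y : measurable (B n y) by exact: measurable_dist_le.
have mwB n y : measurable_fun setT
    (fun x : measurableTypeR R => ((w n)%:E * (\1_(B n y) x)%:E)%E).
  by apply: measurable_funeM; apply/measurable_EFinP; exact: measurable_indic.
have wB0 n y x : (0 <= (w n)%:E * (\1_(B n y) x)%:E)%E.
  by rewrite mule_ge0// lee_fin ?indicE.
have mwmu n : measurable_fun setT
    (fun y : measurableTypeR R => ((w n)%:E * mu (B n y))%E).
  by apply: measurable_funeM; exact: measurable_mu_dist_le.
have wmu0 n y : (0 <= (w n)%:E * mu (B n y))%E by rewrite mule_ge0// lee_fin.
have inner y : (\int[mu]_x riesz_kernel s x y <=
    (r `^ (- s))%:E + \sum_(0 <= n <oo) ((w n)%:E * mu (B n y)))%E.
  apply: (@le_trans _ _ (\int[mu]_x ((r `^ (- s))%:E +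
      \sum_(0 <= n <oo) ((w n)%:E * (\1_(B n y) x)%:E)))%E).
    apply: ge0_le_integral => //.
    - by move=> x _; exact: riesz_kernel_ge0.
    - exact: measurable_riesz_kernel_l.
    - by apply: emeasurable_funD => //; apply: ge0_emeasurable_sum.
    - by move=> x _; exact: riesz_kernel_le_series.
  rewrite ge0_integralD//; last 2 first.
    by move=> x _; exact: nneseries_ge0.
    exact: ge0_emeasurable_sum.
  rewrite integral_cst// [X in (_ * X)%E]probability_setT mule1 leeD2l//.
  rewrite integral_nneseries//; apply: lee_nneseries => n _.
    by move=> _; apply: integral_ge0.
  rewrite ge0_integralZl//; last 2 first.
    by apply/measurable_EFinP; exact: measurable_indic.
    by rewrite lee_fin.
  by rewrite integral_indic// setIT.
apply: (@le_lt_trans _ _ (\int[mu]_y ((r `^ (- s))%:E +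
      \sum_(0 <= n <oo) ((w n)%:E * mu (B n y))))%E).
  apply: ge0_le_integral => //.
  - by move=> y _; apply: integral_ge0 => x _; exact: riesz_kernel_ge0.
  - exact: measurable_riesz_potential.
  - by apply: emeasurable_funD => //; apply: ge0_emeasurable_sum.
rewrite ge0_integralD//; last 2 first.
  by move=> x _; exact: nneseries_ge0.
  exact: ge0_emeasurable_sum.
rewrite integral_cst// [X in (_ * X)%E]probability_setT mule1 lte_add_pinfty// ?ltry//.
rewrite integral_nneseries//.
have qs0 : 0 < q `^ s by rewrite powR_gt0.
apply: le_lt_trans (@geometric_nneseries_lty _
  ((q `^ s * r `^ s)^-1 * C) (q `^ alpha / q `^ s) _ _).
- apply: lee_nneseries => n _; first by move=> _; apply: integral_ge0.
  rewrite ge0_integralZl//; last 2 first.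
    exact: measurable_mu_dist_le.
    by rewrite lee_fin.
  apply: (@le_trans _ _ ((w n)%:E * ((q `^ alpha) ^+ n * C)%:E)%E).
    by apply: lee_wpmul2l; [rewrite lee_fin|exact: hC].
  rewrite -EFinM lee_fin /w expr_div_n le_eqVlt; apply/orP; left; apply/eqP.
  by ring.
- by rewrite mulr_ge0// invr_ge0 mulr_ge0// powR_ge0.
- rewrite divr_gt0 ?powR_gt0//= ltr_pdivrMr// mul1r.
  have -> : q `^ alpha = q `^ (alpha - s) * q `^ s.
    by rewrite -powRD ?subrK// (gt_eqF q0) implybT.
  rewrite gtr_pMl//.
  have as0 : 0 < alpha - s by rewrite subr_gt0.
  have := gt0_ltr_powR as0 (ltW q0) ler01 q1.
  by rewrite powR1.
Qed.

(** * Mass distribution principle and Hausdorff dimension *)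

(** Markov's inequality: on the ball the kernel is at least [d^(-s)]. *)
Lemma riesz_potential_ball (R : realType) (s C y d : R)
    (mu : probability (measurableTypeR R) R) :
  0 < s -> 0 <= C -> 0 <= d -> (\int[mu]_x riesz_kernel s x y <= C%:E)%E ->
  (mu [set x | (`|x - y| <= d)%R] <= (d `^ s * C)%:E)%E.
Proof.
move=> s0 C0 d0 hC; set B : set (measurableTypeR R) := [set x | _].
have mB : measurable B.
  by have := measurable_dist_le y 0 d; under eq_set do rewrite subr0.
have key (c : R) : 0 <= c -> (forall x, B x -> (c%:E <= riesz_kernel s x y)%E) ->
    (c%:E * mu B <= C%:E)%E.
  move=> c0 cB; apply: le_trans hC.
  rewrite -[X in mu X]setIT -integral_indic// -ge0_integralZl//; last first.
    by apply/measurable_EFinP; exact: measurable_indic.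
  apply: ge0_le_integral => //.
  - by move=> x _; rewrite mule_ge0// lee_fin.
  - by apply: measurable_funeM; apply/measurable_EFinP; exact: measurable_indic.
  - exact: measurable_riesz_kernel_l.
  - move=> x _; rewrite indicE; have [|_] := boolP (x \in B).
      by rewrite inE mule1 => /cB.
    by rewrite mule0 riesz_kernel_ge0.
have muB : mu B = (fine (mu B))%:E.
  by rewrite fineK// fin_num_measure.
have muB0 : 0 <= fine (mu B) by rewrite fine_ge0.
rewrite muB lee_fin.
(* For [d = 0] the ball is the point [y], where the kernel is infinite. An atom there would allow
   the constant [(C + 1) / mu B] in [key], giving [C + 1 <= C]. *)
have [d_eq0|dn0] := eqVneq d 0.
  rewrite d_eq0 powR0 ?gt_eqF// mul0r leNgt; apply/negP => muB_gt0.
  have /(_ ((C + 1) / fine (mu B))) := key.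
  rewrite muB -EFinM divfK ?gt_eqF// lee_fin gerDl ler10 => /(_ _ _)/negP; apply=> //.
    by rewrite divr_ge0// addr_ge0.
  move=> x; rewrite /B /= d_eq0 normr_le0 subr_eq0 => xy.
  by rewrite /riesz_kernel xy s0 leey.
have dp : 0 < d by rewrite lt_neqAle eq_sym dn0.
rewrite mulrC -ler_pdivrMr ?powR_gt0// mulrC -lee_fin EFinM -muB -powRN.
apply: key; first by rewrite powR_ge0.
move=> x /= xd; rewrite /riesz_kernel s0 andbT; case: eqVneq => [_|xy]; first by rewrite leey.
rewrite lee_fin !powRN lef_pV2 ?posrE ?powR_gt0 ?normr_gt0 ?subr_eq0//.
by rewrite ge0_ler_powR// ?nnegrE ?ltW.
Qed.

Lemma diam_pow_ge0 (R : realType) (s : R) (U : set R) : (0 <= diam_pow s U)%E.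
Proof. by rewrite /diam_pow; case: ifP => // _; exact: poweR_ge0. Qed.

(** If [t < s], sets of diameter [d <= 1] meeting the region [A] of bounded potential lie in balls
    of mass at most [N d^s <= N d^t]. Covers of [X] with small [t]-sum then make [A] null within
    [X], so the potential exceeds [N] almost everywhere, against the choice of [N]. *)
Lemma energy_le_hausdorff (R : realType) (mu : probability (measurableTypeR R) R)
    (X : set (measurableTypeR R)) (s t : R) :
  (energy mu s < +oo)%E -> measurable X -> mu X = 1%E ->
  0 <= t -> hausdorff_measure t X = 0%E -> s <= t.
Proof.
move=> Es mX muX t0 HX; rewrite leNgt; apply/negP => ts.
have s0 : 0 < s by exact: le_lt_trans ts.
pose phi (y : measurableTypeR R) : \bar R := (\int[mu]_x riesz_kernel s x y)%E.
have phi0 y : (0 <= phi y)%E by apply: integral_ge0 => x _; exact: riesz_kernel_ge0.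
have mphi : measurable_fun setT phi by exact: measurable_riesz_potential.
have E0 : (0 <= energy mu s)%E by apply: integral_ge0 => y _; exact: phi0.
have EE : energy mu s = (fine (energy mu s))%:E by rewrite fineK// ge0_fin_numE.
(* Any [N] above the energy works: Markov's inequality then forbids the complement of [A] from
   having full measure. *)
pose N := fine (energy mu s) + 1.
have N0 : 0 < N by rewrite ltr_wpDl// fine_ge0.
pose A : set (measurableTypeR R) := [set y | (phi y <= N%:E)%E].
have mA : measurable A.
  by rewrite -[A]setTI; exact: emeasurable_fun_infty_c.
(* Covering sets may be non-measurable, so each is replaced by a closed ball of radius [diam U]
   centred at a point of [U] in [A], where the potential bound holds. *)
have cover_one (U : set R) : (diam U <= 1%:E)%E ->
    exists V : set (measurableTypeR R), [/\ measurable V, U `&` (A `&` X) `<=` V &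
      (mu V <= N%:E * diam_pow t U)%E].
  move=> U1; have [->|/set0P[y [Uy [Ay Xy]]]] := eqVneq (U `&` (A `&` X)) set0.
    exists set0; split => //; rewrite measure0; apply: mule_ge0.
      by rewrite lee_fin ltW.
    exact: diam_pow_ge0.
  have dU x : U x -> (`|x - y|%:E <= diam U)%E.
    by move=> Ux; apply: ereal_sup_ubound; exists x => //; exists y.
  have d0 : (0 <= diam U)%E by rewrite (le_trans _ (dU _ Uy)).
  have dE : diam U = (fine (diam U))%:E.
    by rewrite fineK// ge0_fin_numE// (le_lt_trans U1)// ltry.
  set d := fine (diam U) in dE; rewrite dE !lee_fin in U1 d0.
  exists [set x | `|x - y| <= d]; split.
  - by have := measurable_dist_le y 0 d; under eq_set do rewrite subr0.
  - by move=> x [Ux _] /=; rewrite -lee_fin -dE; exact: dU.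
  - apply: le_trans (riesz_potential_ball s0 (ltW N0) d0 Ay) _.
    rewrite /diam_pow ifF; last by apply/eqP => U0; rewrite U0 in Uy.
    rewrite dE poweR_EFin -EFinM lee_fin mulrC ler_wpM2l//; first exact: ltW.
    (* At [d = 0] the left power is 0 since [s > 0], while the right one is 1 when [t = 0]. *)
    have [->|dn0] := eqVneq d 0.
      by rewrite powR0 ?powR_ge0// lt0r_neq0.
    by apply: ger_powR; [rewrite lt_neqAle eq_sym dn0 d0|exact: ltW].
have AX0 : mu (A `&` X) = 0%E.
  apply/eqP; rewrite eq_le measure_ge0 andbT; apply/lee_addgt0Pr => e e0.
  rewrite add0e.
  (* Scale 1 suffices: it is what [d^s <= d^t] requires, and its premeasure is bounded by the
     vanishing Hausdorff measure. *)
  have : (hausdorff_premeasure t 1 X < (e / N)%:E)%E.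
    apply: (@le_lt_trans _ _ 0%E); last by rewrite lte_fin divr_gt0.
    by rewrite -HX; apply: ereal_sup_ubound; exists 1 => //=.
  move=> /ereal_inf_lt[_ [U [XU U1] <-] UeN].
  have /choice[V hV] i := cover_one (U i) (U1 i).
  apply: (@le_trans _ _ (\sum_(0 <= i <oo) mu (V i))%E).
    apply: measure_sigma_subadditive => //.
    - by move=> i; case: (hV i).
    - exact: measurableI.
    - move=> x [Ax Xx]; have [i _ Ux] := XU x Xx; exists i => //.
      by case: (hV i) => _ /(_ x) + _; apply.
  apply: (@le_trans _ _ (\sum_(0 <= i <oo) N%:E * diam_pow t (U i))%E).
    by apply: lee_nneseries => // i _; case: (hV i).
  rewrite nneseriesZl => [|i _]; last exact: diam_pow_ge0.
  rewrite -(divfK (lt0r_neq0 N0) e) [e / N * N]mulrC EFinM.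
  by apply: lee_wpmul2l; [rewrite lee_fin ltW|exact: ltW].
have muA1 : (1 <= mu (~` A))%E.
  rewrite -muX; apply: (@le_trans _ _ (mu (A `&` X) + mu (~` A))%E); last first.
    by rewrite AX0 add0e.
  apply: (@le_trans _ _ (mu ((A `&` X) `|` ~` A))).
    apply: le_measure; rewrite ?inE//.
      by apply: measurableU; [exact: measurableI|exact: measurableC].
    by move=> x Xx; have [Ax|nAx] := pselect (A x); [left|right].
  by apply: measureU2; [exact: measurableI|exact: measurableC].
have : (N%:E * mu (~` A) <= energy mu s)%E.
  have mAc : measurable (~` A) by exact: measurableC.
  rewrite -[X in mu X]setIT -integral_indic// -ge0_integralZl//; last 2 first.
    by apply/measurable_EFinP; exact: measurable_indic.
    by rewrite lee_fin ltW.
  apply: ge0_le_integral => //.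
  - by move=> x _; rewrite mule_ge0// lee_fin// ltW.
  - by apply: measurable_funeM; apply/measurable_EFinP; exact: measurable_indic.
  - move=> x _; rewrite indicE; have [|_] := boolP (x \in ~` A).
      by rewrite inE mule1 /A /= => /negP; rewrite -ltNge => /ltW.
    by rewrite mule0; exact: phi0.
apply/negP; rewrite -ltNge EE.
apply: (@lt_le_trans _ _ N%:E); first by rewrite lte_fin ltrDl.
by rewrite -[leLHS]mule1; apply: lee_wpmul2l => //; rewrite lee_fin ltW.
Qed.

Lemma correlation_dim_le_hausdorff (R : realType)
    (mu : probability (measurableTypeR R) R) :
  (correlation_dim mu <= hausdorff_dim_measure mu)%E.
Proof.
apply: ge_ereal_sup => _ [s Es <-].
apply: le_ereal_inf_tmp => _ [X [mX muX] <-].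
apply: le_ereal_inf_tmp => _ [t [t0 HX] <-].
by rewrite lee_fin (energy_le_hausdorff Es mX muX).
Qed.

Theorem theorem1p17 (R : realType) (S : ifs R)
    (mu : probability (measurableTypeR R) R) (mu_stat : stationary S mu)
    (alpha : R) (alpha_gt0 : 0 < alpha)
    (J : set R) (J_adm : admissible S J) (J_compact : compact J)
    (psi : R -> R) (psi_ge0 : forall x, 0 <= psi x)
    (psi_out : forall x, ~ J x -> psi x = 0)
    (psi_bnd : exists m M : R, 0 < m /\ forall x, J x -> m <= psi x <= M)
    (psi_lt : forall x, J x -> sym_diffusion alpha S psi x < psi x) :
  (correlation_dim mu <= hausdorff_dim_measure mu)%E /\
  (alpha%:E <= correlation_dim mu)%E.
Proof.
split; first exact: correlation_dim_le_hausdorff.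
have [m [M [m0 mM]]] := psi_bnd.
have [|x /psi_lt/ltW//|r r0 decay] := @correlation_integral_decay _ _ _ alpha _ psi m
  mu_stat J_adm J_compact psi_out m0.
  by move=> x /mM /andP[].
have Es (s : R) : 0 < s < alpha -> (s%:E <= correlation_dim mu)%E.
  move=> s_alpha; apply: ereal_sup_ubound; exists s => //=.
  apply: (energy_lty (ifs_ratio_itv S) r0 _ s_alpha (fun n => decay n 0)).
  by rewrite divr_ge0// ltW.
apply/lee_addgt0Pr => e e0.
(* The maximum with [alpha / 2] keeps the exponent positive when [e] is large. *)
pose s := Num.max (alpha / 2) (alpha - e).
have sa : alpha - e <= s by rewrite le_max lexx orbT.
apply: (@le_trans _ _ (s%:E + e%:E)%E); first by rewrite -EFinD lee_fin; lra.
apply: leeD => //; apply: Es; rewrite lt_max divr_gt0//= gt_max; apply/andP; split; lra.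
Qed.
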